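(* Let $\kappa$ be an infinite cardinal and let $\mathbb{J}$ be an $\mathbb{F}_1$-composable class of filters included in $\mathbb{F}_1^{\diamondsuit_\kappa}$. Let $\mathcal{F}$ be a filter on a set $X$. The following are equivalent: (1) $\mathcal{F}\in\ker(\mathbb{J}^{\diamondsuit_\kappa})$; (2) $\mathcal{F}\in\mathbb{J}^{\diamondsuit_\kappa}$ and $A\vee\mathcal{F}\in\ker(\mathbb{J}^{\diamondsuit_\kappa})$ for all $A\subseteq X$ such that $A\#\mathcal{F}$ and $|A|\le\kappa$; (3) for any $\mathbb{J}$-expandable presentation $\gamma:I\times J\to 2^X$ such that $\gamma_*\#\mathcal{F}$, there exists a subset $C$ of $I$ of cardinality at most $\kappa$ such that $\{\bigcup_{\alpha\in C}\gamma(\alpha,\beta):\beta\in J\}\#\mathcal{F}$; (4) for any $\mathbb{J}$-expandable presentation $\gamma:\mathcal{F}\times\mathcal{J}\to 2^X$ such that $\gamma_*\#\mathcal{F}$, where $\mathcal{J}$ is a $\mathbb{J}$-filter (on some set) and each set $\gamma(F,J)$ ($F\in\mathcal{F}$, $J\in\mathcal{J}$) is a subset of $F$ of cardinality at most $\kappa$, there exists a subfamily $\mathcal{K}$ of $\mathcal{F}$ of cardinality at most $\kappa$ such that $\{\bigcup_{F\in\mathcal{K}}\gamma(F,J):J\in\mathcal{J}\}\#\mathcal{F}$.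
   Context: Filters are proper. A class $\mathbb{J}$ of filters prescribes for each set $X$ a subset $\mathbb{J}(X)$ of the set $\mathbb{F}(X)$ of filters on $X$. $\mathbb{F}_1$ is the class of principal filters $A^\uparrow=\{B\subseteq X:A\subseteq B\}$ ($A\ne\varnothing$); a set is identified with its principal filter. For a family $\mathcal{A}\subseteq 2^X$, $\mathcal{A}^\uparrow$ is the family of subsets of $X$ containing an element of $\mathcal{A}$. Two families of sets mesh, $\mathcal{F}\#\mathcal{G}$, if $F\cap G\ne\varnothing$ for all $F\in\mathcal{F}$, $G\in\mathcal{G}$ (and $A\#\mathcal{F}$ means $A\cap F\neq\varnothing$ for all $F\in\mathcal{F}$). If filters mesh, $\mathcal{F}\vee\mathcal{G}$ is the filter generated by the sets $F\cap G$. For filters on $X$, $\mathcal{F}\diamondsuit_\kappa\mathcal{H}$ means: if $\mathcal{H}\#\mathcal{F}$, then there is $A\subseteq X$ with $|A|\le\kappa$ and $A\#(\mathcal{F}\vee\mathcal{H})$. For a class $\mathbb{J}$, $\mathbb{J}^{\diamondsuit_\kappa}(X)=\{\mathcal{F}\in\mathbb{F}(X):\mathcal{F}\diamondsuit_\kappa\mathcal{G}\text{ for all }\mathcal{G}\in\mathbb{J}(X)\}$. For $A\subseteq X\times Y$ and a filter $\mathcal{F}$ on $X$ with $A\#(\mathcal{F}\times Y)$ (where $\mathcal{F}\times Y$ is generated by the sets $F\times Y$), $A\mathcal{F}$ is the filter on $Y$ generated by the sets $AF=\{y:\exists x\in F,(x,y)\in A\}$. $\mathbb{J}$ is $\mathbb{F}_1$-composable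 if always $A\mathcal{F}\in\mathbb{J}(Y)$ when $\mathcal{F}\in\mathbb{J}(X)$. $\ker(\mathbb{J})$ is the class of filters $\mathcal{F}$ (on a set $X$) such that $A\mathcal{F}\in\mathbb{J}(Y)$ for every set $Y$ and every $A\subseteq X\times Y$ with $A\#(\mathcal{F}\times Y)$. For sets $I,J$, a function $\gamma:I\times J\to 2^X$ is called a presentation on $X$; $\gamma_*=\{\bigcup_{\alpha\in I}\gamma(\alpha,\beta):\beta\in J\}^\uparrow$. The presentation is $\mathbb{J}$-expandable if $\gamma^*=\{\bigcup_{\alpha\in I}\gamma(\alpha,\beta)\times\{\alpha\}:\beta\in J\}^\uparrow$ is a $\mathbb{J}$-filter on $X\times I$. *)

(* Defs.v *)
From mathcomp Require Export all_boot.
From mathcomp Require Export boolp classical_sets functions cardinality filter.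

Set Implicit Arguments.
Unset Strict Implicit.
Unset Printing Implicit Defensive.

#[global] Open Scope classical_set_scope.
#[global] Open Scope card_scope.

(* A cardinal is given by a type kappa of that cardinality, so |A| <= kappa reads
   A #<= [set: kappa].  For a set A and a family F, A # F reads [set A] `#` F.
   filter_from D B is the family of all supersets of the sets B i, i in D. *)

(* That JJ X consists of proper filters is the separate condition
   is_filter_class. *)
Definition filter_class := forall X : Type, set (set_system X).

Definition is_filter_class (JJ : filter_class) :=
  forall (X : Type) (F : set_system X), JJ X F -> ProperFilter F.

Definition subclass (JJ KK : filter_class) :=
  forall X : Type, JJ X `<=` KK X.

(* globally A is the principal filter of A. *)
Definition principal : filter_class := fun X =>
  [set F | exists2 A : set X, A !=set0 & F = globally A].

Definition filter_vee (X : Type) (F G : set_system X) : set_system X :=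
  filter_from (F `*` G) (fun P => P.1 `&` P.2).

Definition diamond (kappa X : Type) (F H : set_system X) :=
  H `#` F ->
  exists2 A : set X, A #<= [set: kappa] & [set A] `#` filter_vee F H.

Definition diamond_class (kappa : Type) (JJ : filter_class) : filter_class :=
  fun X => [set F | ProperFilter F /\
                    forall G : set_system X, JJ X G -> diamond kappa F G].

Definition rel_image (X Y : Type) (A : set (X * Y)) (B : set X) : set Y :=
  [set y | exists2 x, B x & A (x, y)].

(* The filter F x Y. *)
Definition cylinder (X Y : Type) (F : set_system X) : set_system (X * Y) :=
  filter_from F (fun B => B `*` [set: Y]).
Arguments cylinder {X} Y F.

Definition rel_filter (X Y : Type) (A : set (X * Y)) (F : set_system X) :
    set_system Y :=
  filter_from F (rel_image A).

Definition F1_composable (JJ : filter_class) :=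
  forall (X Y : Type) (A : set (X * Y)) (F : set_system X),
    JJ X F -> [set A] `#` cylinder Y F -> JJ Y (rel_filter A F).

Definition ker (JJ : filter_class) : filter_class := fun X =>
  [set F | ProperFilter F /\
           forall (Y : Type) (A : set (X * Y)),
             [set A] `#` cylinder Y F -> JJ Y (rel_filter A F)].

Definition presentation (I J X : Type) := I -> J -> set X.

(* lower_pres gamma and upper_pres gamma are gamma_* and gamma^*. *)
Definition lower_pres (I J X : Type) (gamma : presentation I J X) :
    set_system X :=
  filter_from [set: J] (fun beta => \bigcup_alpha gamma alpha beta).

Definition upper_pres (I J X : Type) (gamma : presentation I J X) :
    set_system (X * I) :=
  filter_from [set: J]
    (fun beta => \bigcup_alpha (gamma alpha beta `*` [set alpha])).

Definition expandable (JJ : filter_class) (I J X : Type)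
    (gamma : presentation I J X) :=
  JJ (X * I)%type (upper_pres gamma).

(* Not closed under supersets, unlike lower_pres. *)
Definition restr_pres (I J X : Type) (gamma : presentation I J X) (C : set I) :
    set_system X :=
  range (fun beta => \bigcup_(alpha in C) gamma alpha beta).

(* Main.v *)
Require Import Defs.

Set Implicit Arguments.
Unset Strict Implicit.
Unset Printing Implicit Defensive.

(** Write L for [diamond_class kappa JJ].

    The class [ker L] is closed under joins with sets ([ker_vee]), since the
    image of the join of A and F by R is the image of F by R restricted to A.
    So membership in [ker L] implies its local form.

    A filter F of [ker L] has the covering property for expandable
    presentations ([ker_diamond_pres]): the filter F x I is the image of F by a
    relation from X to X x I, so it lies in L; since it meshes with the
    JJ-filter gamma^*, some set S of at most kappa points of X x I meshes with
    the join of the two, and the second coordinates of the points of S form the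
    required C.  If only the local form is given, then gamma_*, a projection of
    gamma^*, is a JJ-filter, so that F in L yields a set A of size at most kappa
    meshing with the join of F and gamma_*; the previous argument applies to the
    join of A and F ([local_ker_diamond_pres]).

    Conversely ([pres_diamond_ker]), let H be a JJ-filter meshing with the image
    of F by a relation R.  For each A in F, H meshes with the set R(A), and
    JJ-filters are in the diamond class of the principal filters, so there is a
    set S_A of at most kappa pairs of R with first coordinates in A, whose
    second coordinates mesh with H.  Put
      gamma(A, B) = {x | (x, y) in S_A for some y in B}.
    Then gamma^* is the image of H by a relation, so gamma is expandable, and
    the covering property gives at most kappa sets A such that the second
    coordinates of the points of the S_A mesh with the join of R(F) and H.

    This last step needs a union of at most kappa sets of size at most kappa to
    have size at most kappa ([bigcup_card_le]), that is, the theorem that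
    kappa * kappa = kappa for an infinite cardinal kappa, which is obtained here
    from Zorn's lemma ([card_setXself_le]). *)

(** * Products and unions of infinite cardinals *)

(** Injections are handled as relations that are total on A and never send two
    points of A to the same point.  Functionality is not required, so that such
    relations can be given without choosing values. *)
Lemma card_le_relP (T U : Type) (A : set T) (B : set U) :
  A #<= B <-> exists R : T -> U -> Prop,
    (forall x, A x -> exists2 y, B y & R x y) /\
    (forall x x' y, A x -> A x' -> R x y -> R x' y -> x = x').
Proof.
split.
  move=> /card_leP[f].
  exists (fun x y => exists2 a : A, set_val a = x & set_val (f a) = y).
  split=> [x Ax|x x' y _ _ [a <- <-] [a' <- faa']].
    exists (set_val (f (SigSub (mem_set Ax)))); first exact: set_valP.
    by exists (SigSub (mem_set Ax)).
  by congr set_val; apply: (@inj _ _ _ f); rewrite ?inE //; apply: val_inj.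
move=> [R [totR injR]].
have /choice[g gR] : forall a : A, exists b : B, R (set_val a) (set_val b).
  move=> a; have [y By Rxy] := totR _ (set_valP a).
  by exists (SigSub (mem_set By)).
apply/card_leP/injfunPex; exists g => // a a' _ _ gaa'.
apply: val_inj; apply: (injR _ _ (set_val (g a))).
- exact: set_valP.
- exact: set_valP.
- exact: gR.
- rewrite gaa'; exact: gR.
Qed.

Lemma card_leX (T T' U U' : Type) (A : set T) (A' : set T')
    (B : set U) (B' : set U') :
  A #<= B -> A' #<= B' -> A `*` A' #<= B `*` B'.
Proof.
move=> /card_le_relP[R [totR injR]] /card_le_relP[R' [totR' injR']].
apply/card_le_relP; exists (fun p q => R p.1 q.1 /\ R' p.2 q.2); split.
  move=> [x x'] [/= /totR[y By Rxy] /totR'[y' By' Rxy']].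
  by exists (y, y').
move=> [x x'] [z z'] y [/= Ax Ax'] [/= Az Az'] [? ?] [? ?].
by congr pair; [apply: injR|apply: injR']; eassumption.
Qed.

(** The disjoint sum of two copies of D is embedded in the square of D by
    labelling the copies with two distinct points of D. *)
Lemma card_leU (T U : Type) (A B : set T) (D : set U) (d0 d1 : U) :
  D d0 -> D d1 -> d0 <> d1 -> A #<= D -> B #<= D -> A `|` B #<= D `*` D.
Proof.
move=> Dd0 Dd1 d01 /card_le_relP[R [totR injR]] /card_le_relP[R' [totR' injR']].
apply/card_le_relP.
exists (fun x q => (A x /\ R x q.1 /\ q.2 = d0) \/
                   (B x /\ R' x q.1 /\ q.2 = d1)); split.
  move=> x [Ax|Bx].
    by have [y Dy Rxy] := totR _ Ax; exists (y, d0) => //; left.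
  by have [y Dy Rxy] := totR' _ Bx; exists (y, d1) => //; right.
move=> x x' [y d] _ _ /= [[Ax [Rx ->]]|[Ax [Rx ->]]]
  [[Ax' [Rx' /esym d0d]]|[Ax' [Rx' d1d]]].
- exact: injR Rx Rx'.
- by case: d01.
- by case: d01.
- exact: injR' Rx Rx'.
Qed.

(** A maximal matching between A and B exhausts A or B. *)
Lemma card_le_total (T U : Type) (A : set T) (B : set U) :
  A #<= B \/ B #<= A.
Proof.
pose P (M : set (T * U)) := M `<=` A `*` B /\
  forall p q, M p -> M q -> p.1 = q.1 <-> p.2 = q.2.
have [C CP Ctot|M [[MAB Minj] Mmax]] := @Zorn_bigcup _ P.
  split=> [p [M /CP[MAB _] /MAB//]|p q [M CM Mp] [N CN Nq]].
  have [MN|NM] := Ctot _ _ CM CN.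
    by have [_] := CP _ CN; apply=> //; apply: MN.
  by have [_] := CP _ CM; apply=> //; apply: NM.
have [[x Ax xN]|Adom] :=
  pselect (exists2 x, A x & forall y, ~ M (x, y)); last first.
  left; apply/card_le_relP; exists (fun x y => M (x, y)); split.
    move=> x Ax; apply: contrapT => xN; apply: Adom; exists x => // y Mxy.
    by apply: xN; exists y => //; have [] := MAB _ Mxy.
  by move=> x x' y _ _ Mxy Mxy'; have [_] := Minj _ _ Mxy Mxy'; apply.
have [[y By yN]|Brng] :=
  pselect (exists2 y, B y & forall x, ~ M (x, y)); last first.
  right; apply/card_le_relP; exists (fun y x => M (x, y)); split.
    move=> y By; apply: contrapT => yN; apply: Brng; exists y => // x' Mxy.
    by apply: yN; exists x' => //; have [] := MAB _ Mxy.
  by move=> y y' x' _ _ Mxy Mxy'; have [+ _] := Minj _ _ Mxy Mxy'; apply.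
(* Two unmatched points could be matched with each other. *)
exfalso; apply: (Mmax (M `|` [set (x, y)])).
  split; first by move=> p; left.
  by move=> /(_ (x, y) (or_intror erefl)); apply: xN.
split=> [p [/MAB//|->]//|].
move=> [p p'] [q q'] [Mp|[-> ->]] [Mq|[-> ->]] //=; first exact: Minj Mp Mq.
- by split=> E; [case: (xN p')|case: (yN p)]; rewrite -?E // ?E.
- by split=> E; [case: (xN q')|case: (yN q)]; rewrite ?E // -?E.
Qed.

(** Zorn's lemma is applied to the pairing relations G on T, in which every
    point codes at most one pair and every pair of points of the range D of G
    has a code; each of them gives D * D <= D.  Let G be maximal and infinite.
    If the complement of D is no larger than D, then T is no larger than D.
    Otherwise the complement of D contains a copy E of D, and the new pairs of
    points of the union of D and E can all be coded in E, against the
    maximality of G. *)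
Lemma card_setXself_le (T : Type) :
  infinite_set [set: T] -> [set: T] `*` [set: T] #<= [set: T].
Proof.
move=> /infiniteP/card_leP/injfunPex[i0 _ i0inj].
pose i (n : nat) : T := set_val (i0 (SigSub (mem_set (I : [set: nat] n)))).
have i_inj : injective i.
  by move=> m n /val_inj E; have [] := i0inj _ _ (in_setT _) (in_setT _) E.
pose rng (G : set ((T * T) * T)) := [set z | exists p, G (p, z)].
pose good (G : set ((T * T) * T)) :=
  (forall p q z, G (p, z) -> G (q, z) -> p = q) /\
  (forall x y, rng G x -> rng G y -> exists z, G ((x, y), z)).
have card_rng G : good G -> rng G `*` rng G #<= rng G.
  move=> [injG totG]; apply/card_le_relP; exists (fun p z => G (p, z)).
  split=> [[x y] [/= Gx Gy]|p q z _ _]; last exact: injG.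
  by have [z Gz] := totG _ _ Gx Gy; exists z => //; exists (x, y).
pose G0 : set ((T * T) * T) :=
  range (fun ab : nat * nat => ((i ab.1, i ab.2), i (pickle ab))).
have goodG0 : good G0.
  split=> [p q z [ab _ [<- <-]] [cd _ [<- /i_inj/(pcan_inj pickleK)->]]//|].
  move=> x y [p [[a b] _ [_ <-]]] [q [[c d] _ [_ <-]]].
  exists (i (pickle (pickle (a, b), pickle (c, d)))).
  by exists (pickle (a, b), pickle (c, d)).
(* Containing G0 keeps the maximal element infinite; the case of set0 is there
   for the union of the empty chain. *)
pose P G := good G /\ (G = set0 \/ G0 `<=` G).
have [C CP Ctot|G [[Ggood GG0] Gmax]] := @Zorn_bigcup _ P.
  have Cdir M N : C M -> C N -> exists2 L, C L & M `|` N `<=` L.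
    move=> CM CN; have [MN|NM] := Ctot _ _ CM CN.
      by exists N => // x [/MN|].
    by exists M => // x [|/NM].
  split; last first.
    have [[M CM G0M]|C0] := pselect (exists2 M, C M & G0 `<=` M).
      by right=> p /G0M Mp; exists M.
    left; apply/seteqP; split=> // p [M CM Mp].
    by have [_ [M0|G0M]] := CP _ CM; [rewrite M0 in Mp|case: C0; exists M].
  split=> [p q z [M CM Mp] [N CN Nq]|x y [p [M CM Mp]] [q [N CN Nq]]].
    have [L CL MNL] := Cdir _ _ CM CN; have [[injL _] _] := CP _ CL.
    by apply: (injL _ _ z); apply: MNL; [left|right].
  have [L CL MNL] := Cdir _ _ CM CN; have [[_ totL] _] := CP _ CL.
  have [| |z Lz] := totL x y; last by exists z, L.
    by exists p; apply: MNL; left.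
  by exists q; apply: MNL; right.
have {GG0} G0G : G0 `<=` G.
  case: GG0 => // G_0; case: (Gmax G0); last by split=> //; right.
  rewrite G_0; split=> // /(_ _ (imageT _ (0, 0)%N)); exact.
pose D := rng G.
have [d0 [d1 [Dd0 Dd1 d01]]] : exists d0 d1, [/\ D d0, D d1 & d0 <> d1].
  exists (i (pickle (0, 0)%N)), (i (pickle (0, 1)%N)); split.
  - by exists (i 0, i 0)%N; apply: G0G; exists (0, 0)%N.
  - by exists (i 0, i 1)%N; apply: G0G; exists (0, 1)%N.
  - by move=> /i_inj /(pcan_inj pickleK).
have DD : D `*` D #<= D by exact: card_rng.
have [DC|CD] := card_le_total D (~` D); last first.
  have TD : [set: T] #<= D.
    rewrite -(setUv D); apply: card_le_trans DD.
    exact: card_leU Dd0 Dd1 d01 (card_lexx _) CD.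
  exact: card_le_trans (card_leX TD TD) (card_le_trans DD (card_leT _)).
exfalso.
(* E is a copy of D outside D. *)
have /card_subP[E] := DC; rewrite card_eq_le => /andP[ED' DE] ED.
have /card_le_relP[e [tote inje]] : (D `|` E) `*` (D `|` E) #<= E.
  have DED : D `|` E #<= D.
    exact: card_le_trans (card_leU Dd0 Dd1 d01 (card_lexx _) ED') DD.
  exact: card_le_trans (card_leX DED DED) (card_le_trans DD DE).
pose H := G `|` [set pz | [/\ ((D `|` E) `*` (D `|` E)) pz.1,
                            ~ (D `*` D) pz.1, E pz.2 & e pz.1 pz.2]].
have rngH : rng H `<=` D `|` E.
  by move=> z [p [Gz|[_ _ Ez _]]]; [left; exists p|right].
have [x Ex] : exists x, E x.
  have /card_le_relP[R [totR _]] := DE.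
  by have [x Ex _] := totR _ Dd0; exists x.
case: (Gmax H).
  split; first by move=> pz; left.
  have DEx : ((D `|` E) `*` (D `|` E)) (x, x) by split; right.
  have [z Ez exz] := tote _ DEx.
  move=> HG; apply: (ED z) => //; exists (x, x); apply: HG; right.
  by split=> //= -[/(ED _ Ex)].
have [injG totG] := Ggood.
split; last by right=> pz /G0G; left.
split.
  move=> p q z [Gp|[/= DEp _ Ez ep]] [Gq|[/= DEq _ Ez' eqz]].
  - exact: injG Gp Gq.
  - by case: (ED _ Ez'); exists p.
  - by case: (ED _ Ez); exists q.
  - exact: inje ep eqz.
move=> y y' /rngH DEy /rngH DEy'.
have [[Dy Dy']|nD] := pselect ((D `*` D) (y, y')).
  by have [z Gz] := totG _ _ Dy Dy'; exists z; left.
have [z Ez ez] := tote (y, y') (conj DEy DEy').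
by exists z; right.
Qed.

Lemma bigcup_card_le (kappa I T : Type) (C : set I) (A : I -> set T) :
  infinite_set [set: kappa] -> C #<= [set: kappa] ->
  (forall i, C i -> A i #<= [set: kappa]) ->
  \bigcup_(i in C) A i #<= [set: kappa].
Proof.
move=> /card_setXself_le kk /card_le_relP[R [totR injR]] Ale.
apply: card_le_trans kk.
have /choice[S SP] : forall i, exists S : T -> kappa -> Prop, C i ->
    (forall x, A i x -> exists2 k, [set: kappa] k & S x k) /\
    (forall x y k, A i x -> A i y -> S x k -> S y k -> x = y).
  move=> i; have [Ci|nCi] := pselect (C i); last by exists (fun _ _ => True).
  by have /card_le_relP[S SP] := Ale _ Ci; exists S.
apply/card_le_relP.
exists (fun x p => exists2 i, C i /\ R i p.1 & A i x /\ S i x p.2); split.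
  move=> x [i Ci Aix]; have [k _ Rik] := totR _ Ci.
  have [k' _ Sik'] := (SP _ Ci).1 _ Aix.
  by exists (k, k') => //; exists i.
move=> x y [k k'] _ _ /= [i [Ci Rik] [Aix Six]] [j [Cj Rjk] [Ajy Sjy]].
have ij := injR _ _ _ Ci Cj Rik Rjk; subst j.
exact: (SP _ Ci).2 Aix Ajy Six Sjy.
Qed.

(** * Meshing conditions on generating sets *)

(** The intersections A `&` B generate the join of F and G, so meshing with the
    join can be tested on them. *)
Lemma diamond_classP (kappa : Type) (JJ : filter_class) (X : Type)
    (F : set_system X) : ProperFilter F ->
  diamond_class kappa JJ F <->
  forall G, JJ X G -> (forall A B, F A -> G B -> A `&` B !=set0) ->
    exists2 S : set X, S #<= [set: kappa] &
      forall A B, F A -> G B -> S `&` (A `&` B) !=set0.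
Proof.
move=> PF; split.
  move=> [_ dF] G JG FG; have [|S Sk SFG] := dF G JG.
    by move=> B A GB FA; rewrite setIC; apply: FG.
  exists S => // A B FA GB; apply: SFG => //.
  exact: (@in_filter_from _ _ (F `*` G) (fun P => P.1 `&` P.2) (A, B)).
move=> dF; split=> // G JG GF; have [|S Sk SFG] := dF G JG.
  by move=> A B FA GB; rewrite setIC; apply: GF.
exists S => // _ U -> [[A B] [/= FA GB] ABU].
by have [x [Sx /ABU Ux]] := SFG _ _ FA GB; exists x.
Qed.

Lemma cylinder_meets (X Y : Type) (A : set (X * Y)) (F : set_system X) :
  [set A] `#` cylinder Y F <->
  forall B, F B -> exists x y, B x /\ A (x, y).
Proof.
split=> [AF B FB|AF _ U -> [B FB BU]].
  have [|[x y] [Axy [Bx _]]] := AF A (B `*` [set: Y]) erefl.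
    exact: in_filter_from.
  by exists x, y.
by have [x [y [Bx Axy]]] := AF _ FB; exists (x, y); split=> //; apply: BU.
Qed.

Lemma lower_pres_meets (I J X : Type) (gamma : presentation I J X)
    (F : set_system X) :
  lower_pres gamma `#` F <->
  forall b B, F B -> exists a x, gamma a b x /\ B x.
Proof.
split=> [gF b B FB|gF U B [b _ gbU] FB].
  have [|x [[a _ gx] Bx]] := gF (\bigcup_a gamma a b) B _ FB.
    exact: in_filter_from.
  by exists a, x.
have [a [x [gx Bx]]] := gF b _ FB.
by exists x; split=> //; apply: gbU; exists a.
Qed.

Lemma restr_pres_meets (I J X : Type) (gamma : presentation I J X) (C : set I)
    (F : set_system X) :
  restr_pres gamma C `#` F <->
  forall b B, F B -> exists a x, [/\ C a, gamma a b x & B x].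
Proof.
split=> [gF b B FB|gF _ B [b _ <-] FB].
  have [|x [[a Ca gx] Bx]] := gF (\bigcup_(a in C) gamma a b) B _ FB.
    by exists b.
  by exists a, x.
by have [a [x [Ca gx Bx]]] := gF b _ FB; exists x; split=> //; exists a.
Qed.

(** * Images of filters by relations *)

Lemma rel_filter_proper (X Y : Type) (A : set (X * Y)) (F : set_system X) :
  ProperFilter F -> [set A] `#` cylinder Y F -> ProperFilter (rel_filter A F).
Proof.
move=> PF /cylinder_meets AF; apply: filter_from_proper.
  apply: filter_from_filter; first by exists setT; apply: filterT.
  move=> B C FB FC; exists (B `&` C); first exact: filterI.
  by move=> y [x [Bx Cx] Axy]; split; exists x.
by move=> B /AF[x [y [Bx Axy]]]; exists y, x.
Qed.

Lemma filter_vee_globally_proper (X : Type) (A : set X) (F : set_system X) :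
  ProperFilter F -> [set A] `#` F -> ProperFilter (filter_vee (globally A) F).
Proof.
move=> PF AF; apply: filter_from_proper.
  apply: filter_from_filter.
    by exists (setT, setT); split => //=; apply: filterT.
  move=> [B C] [B' C'] [/= AB FC] [/= AB' FC'].
  exists (B `&` B', C `&` C') => /=.
    by split=> /=; [move=> x Ax; split; [apply: AB|apply: AB']|apply: filterI].
  by move=> x [[? ?] [? ?]].
move=> [B C] [/= AB FC]; have [x [Ax Cx]] := AF _ _ erefl FC.
by exists x; split=> //; apply: AB.
Qed.

Lemma rel_filter_diag (X : Type) (F : set_system X) : Filter F ->
  rel_filter [set p : X * X | p.1 = p.2] F = F.
Proof.
move=> FF; apply/seteqP; split=> [B [C FC CB]|B FB].
  by apply: filterS FC => x Cx; apply: CB; exists x.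
by exists B => // y [x Bx /= <-].
Qed.

(** This identity is why [ker JJ] is closed under joins with sets. *)
Lemma rel_filter_vee (X Y : Type) (R : set (X * Y)) (A : set X)
    (F : set_system X) :
  rel_filter R (filter_vee (globally A) F) =
  rel_filter (R `&` (A `*` [set: Y])) F.
Proof.
apply/seteqP; split=> U.
  move=> [B [[C D] [/= AC FD] CDB] RBU]; exists D => // y [x Dx [Rxy [Ax _]]].
  by apply: RBU; exists x => //; apply: CDB; split=> //; apply: AC.
move=> [D FD RDU]; exists (A `&` D).
  by exists (A, D) => //; split => // x.
by move=> y [x [Ax Dx] Rxy]; apply: RDU; exists x.
Qed.

Lemma ker_vee (JJ : filter_class) (X : Type) (A : set X) (F : set_system X) :
  ker JJ F -> [set A] `#` F -> ker JJ (filter_vee (globally A) F).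
Proof.
move=> [PF kF] AF; split; first exact: filter_vee_globally_proper.
move=> Y R /cylinder_meets RF; rewrite rel_filter_vee; apply: kF.
apply/cylinder_meets => B FB.
have [|x [y [[Ax Bx] Rxy]]] := RF (A `&` B).
  by exists (A, B) => //; split => // x.
by exists x, y.
Qed.

Lemma ker_sub (JJ : filter_class) (X : Type) (F : set_system X) :
  ker JJ F -> JJ X F.
Proof.
move=> [PF kF]; rewrite -[F]rel_filter_diag; apply: kF.
by apply/cylinder_meets => B /filter_ex[x Bx]; exists x, x.
Qed.

(** * The covering property for expandable presentations *)

(** The filter F x I is an image of F, hence in the diamond class; a set of at
    most kappa points meshing with F x I and gamma^* is then projected to I. *)
Lemma ker_diamond_pres (kappa : Type) (JJ : filter_class) (X : Type)
    (F : set_system X) (I J : Type) (gamma : presentation I J X) :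
  is_filter_class JJ ->
  ker (diamond_class kappa JJ) F -> expandable JJ gamma ->
  lower_pres gamma `#` F ->
  exists2 C : set I, C #<= [set: kappa] & restr_pres gamma C `#` F.
Proof.
move=> JF [PF kF] gJ /lower_pres_meets gF.
(* J is nonempty because the filter gamma^* contains the whole space; a point
   of I is then provided by the meshing of gamma_* with F. *)
have [b0] : exists b : J, True.
  by have [b _ _] := @filterT _ _ (JF _ _ gJ); exists b.
(* The image of F by R is F x I. *)
pose R : set (X * (X * I)) := [set p | p.1 = p.2.1].
have RF : [set R] `#` cylinder (X * I) F.
  apply/cylinder_meets => B /(gF b0)[a [x [_ Bx]]].
  by exists x, (x, a).
have /diamond_classP := kF _ _ RF.
move=> /(_ (rel_filter_proper PF RF) _ gJ)[|S Sk SRg].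
  move=> U V [B FB BU] [b _ bV]; have [a [x [gx Bx]]] := gF b B FB.
  by exists (x, a); split; [apply: BU; exists x|apply: bV; exists a].
exists (snd @` S); first exact: card_le_trans (card_image_le _ _) Sk.
apply/restr_pres_meets => b B FB.
have [| |[x a] [Sxa [[x' Bx' /= x'x] [a' _ [/= gx aa']]]]] :=
  SRg (rel_image R B) (\bigcup_a (gamma a b `*` [set a])).
- exact: in_filter_from.
- exact: in_filter_from.
move: Bx' gx; rewrite (x'x : x' = x) -(aa' : a = a') => Bx gx.
by exists a, x; split=> //; exists (x, a).
Qed.

(** The lower filter gamma_* is the projection of gamma^* to X. *)
Lemma lower_pres_class (JJ : filter_class) (I J X : Type)
    (gamma : presentation I J X) :
  is_filter_class JJ -> F1_composable JJ -> expandable JJ gamma ->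
  JJ X (lower_pres gamma).
Proof.
move=> JF Jcomp gJ.
pose R : set ((X * I) * X) := [set p | p.1.1 = p.2].
have -> : lower_pres gamma = rel_filter R (upper_pres gamma).
  apply/seteqP; split=> U.
    move=> [b _ bU]; exists (\bigcup_a (gamma a b `*` [set a])).
      exact: in_filter_from.
    move=> y [[x a'] [a _ [gx _]] xy]; apply: bU; exists a => //.
    by rewrite -(xy : x = y).
  move=> [V [b _ bV] VU]; exists b => // x [a _ gx]; apply: VU.
  by exists (x, a) => //; apply: bV; exists a.
apply: Jcomp => //; apply/cylinder_meets => B JB.
have PJ := JF _ _ gJ.
by have [[x a] Bx] := filter_ex JB; exists (x, a), x.
Qed.

(** A set A of at most kappa points that meshes with the join of F and gamma_*
    reduces the claim to [ker_diamond_pres] for the join of A and F. *)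
Lemma local_ker_diamond_pres (kappa : Type) (JJ : filter_class) (X : Type)
    (F : set_system X) (I J : Type) (gamma : presentation I J X) :
  is_filter_class JJ -> F1_composable JJ ->
  diamond_class kappa JJ F ->
  (forall A : set X, [set A] `#` F -> A #<= [set: kappa] ->
     ker (diamond_class kappa JJ) (filter_vee (globally A) F)) ->
  expandable JJ gamma -> lower_pres gamma `#` F ->
  exists2 C : set I, C #<= [set: kappa] & restr_pres gamma C `#` F.
Proof.
move=> JF Jcomp [PF dF] kF gJ gF.
have Jlow := lower_pres_class JF Jcomp gJ.
have /diamond_classP := conj PF dF => /(_ _ Jlow)[|A Ak AFg].
  by move=> U V FU gV; rewrite setIC; apply: gF.
have AF : [set A] `#` F.
  move=> _ B -> FB; have [|x [Ax [Bx _]]] := AFg B setT FB; last by exists x.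
  by have PJ := JF _ _ Jlow; apply: filterT.
have [|C Ck CAF] := ker_diamond_pres JF (kF _ AF Ak) gJ.
  move=> U V gU [[D E] [/= AD FE] DEV].
  have [x [Ax [Ex Ux]]] := AFg _ _ FE gU.
  by exists x; split=> //; apply: DEV; split=> //; apply: AD.
exists C => // U B gU FB; have [|x [Ux [Ax Bx]]] := CAF U (A `&` B) gU.
  by exists (A, B) => //; split => // x.
by exists x.
Qed.

(** * From the covering property back to the kernel *)

(** The hypothesis on principal filters cuts each image R(A) down to at most
    kappa points that still mesh with H.  Choosing one R-predecessor in A for
    each of them gives S_A, so the values of gamma are subsets of A of size at
    most kappa as well. *)
Lemma pres_diamond_ker (kappa : Type) (JJ : filter_class) (X : Type)
    (F : set_system X) :
  infinite_set [set: kappa] -> is_filter_class JJ -> F1_composable JJ ->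
  subclass JJ (diamond_class kappa principal) -> ProperFilter F ->
  (forall (Z : Type) (G : set_system Z), JJ Z G ->
   forall gamma : presentation F G X,
     expandable JJ gamma -> lower_pres gamma `#` F ->
     (forall (A : F) (B : G),
        gamma A B `<=` set_val A /\ gamma A B #<= [set: kappa]) ->
     exists2 K : set F, K #<= [set: kappa] & restr_pres gamma K `#` F) ->
  ker (diamond_class kappa JJ) F.
Proof.
move=> kinf JF Jcomp Jincl PF presF; split=> // Y R RF.
have PRF := rel_filter_proper PF RF.
move/cylinder_meets in RF; apply/diamond_classP => // H JH RFH.
have PH := JF _ _ JH.
have /choice[S SP] : forall A : F, exists S : set (X * Y),
    [/\ S #<= [set: kappa], S `<=` R, forall p, S p -> set_val A p.1 &
        forall B, H B -> exists2 p, S p & B p.2].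
  move=> A; have FA := set_valP A; set B := rel_image R (set_val A).
  have FB : rel_filter R F B by exact: in_filter_from.
  have [x0 [y0 [Ax0 Rxy0]]] := RF _ FA.
  (* x0 is a default value for the points y outside R(A). *)
  have /choice[g gP] : forall y, exists x, B y -> set_val A x /\ R (x, y).
    move=> y; have [[x Ax Rxy]|nBy] := pselect (B y); first by exists x.
    by exists x0.
  have /diamond_classP := Jincl _ _ JH => /(_ (globally B))[||T Tk TP].
  - by exists B => //; exists y0, x0.
  - move=> V W HV BW; have [y [By Vy]] := RFH _ _ FB HV.
    by exists y; split=> //; apply: BW.
  exists ((fun y => (g y, y)) @` (T `&` B)); split.
  - apply: card_le_trans (card_image_le _ _) _.
    by apply: card_le_trans Tk; apply: subset_card_le; apply: subIsetl.
  - by move=> _ [y [_ /gP[_ Ry]] <-].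
  - by move=> _ [y [_ /gP[Ay _]] <-].
  - move=> V HV; have [//|y [Ty [Vy By]]] := TP V B HV.
    by exists (g y, y) => //; exists y.
pose gamma : presentation F H X :=
  fun A B => [set x | exists2 y, set_val B y & S A (x, y)].
have gJ : expandable JJ gamma.
  (* gamma^* is the image of H by Q. *)
  pose Q : set (Y * (X * F)) := [set q | S q.2.2 (q.2.1, q.1)].
  rewrite /expandable; have -> : upper_pres gamma = rel_filter Q H.
    apply/seteqP; split=> U.
      move=> [B _ BU]; exists (set_val B); first exact: set_valP.
      move=> [x A] [y By SA]; apply: BU.
      by exists A => //; split=> //; exists y.
    move=> [B HB BU]; exists (SigSub (mem_set HB)) => //.
    move=> [x A] [A' _ [[y By SA] AA']]; apply: BU; exists y => //.
    by rewrite (AA' : A = A').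
  apply: Jcomp => //; apply/cylinder_meets => B HB.
  have FT : F setT by exact: filterT.
  pose A : F := SigSub (mem_set FT).
  by have [_ _ _ /(_ _ HB)[[x y] Sxy By]] := SP A; exists y, (x, A).
have [||K Kk /restr_pres_meets KF] := presF _ _ JH gamma gJ.
- apply/lower_pres_meets => B A FA; exists (SigSub (mem_set FA)).
  have [_ _ SA /(_ _ (set_valP B))[[x y] Sxy By]] := SP (SigSub (mem_set FA)).
  by exists x; split; [exists y|exact: SA Sxy].
- move=> A B; have [Sk _ SA _] := SP A; split.
    by move=> x [y _ /SA].
  apply: card_le_trans Sk; apply: card_le_trans (card_image_le fst _).
  by apply: subset_card_le => x [y _ Sxy]; exists (x, y).
exists (snd @` (\bigcup_(A in K) S A)).
  apply: card_le_trans (card_image_le _ _) _; apply: bigcup_card_le => // A _.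
  by have [] := SP A.
move=> U V [A FA AU] HV.
have [A' [x [KA' [y Vy Sxy] Ax]]] := KF (SigSub (mem_set HV)) _ FA.
exists y; split; first by exists (x, y) => //; exists A'.
split=> //; apply: AU; exists x => //.
by have [_ SR _ _] := SP A'; apply: SR.
Qed.

Theorem theorem33 (kappa : Type) (kappa_inf : infinite_set [set: kappa])
    (JJ : filter_class) (JJ_filters : is_filter_class JJ)
    (JJ_comp : F1_composable JJ)
    (JJ_incl : subclass JJ (diamond_class kappa principal))
    (X : Type) (F : set_system X) (F_filter : ProperFilter F) :
  [<-> (* (1) *)
       ker (diamond_class kappa JJ) F;
       (* (2) *)
       diamond_class kappa JJ F /\
       (forall A : set X, [set A] `#` F -> A #<= [set: kappa] ->
          ker (diamond_class kappa JJ) (filter_vee (globally A) F));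
       (* (3) *)
       (forall (I J : Type) (gamma : presentation I J X),
          expandable JJ gamma -> lower_pres gamma `#` F ->
          exists2 C : set I, C #<= [set: kappa] & restr_pres gamma C `#` F);
       (* (4) *)
       (forall (Z : Type) (G : set_system Z), JJ Z G ->
        forall gamma : presentation F G X,
          expandable JJ gamma -> lower_pres gamma `#` F ->
          (forall (A : F) (B : G),
             gamma A B `<=` set_val A /\ gamma A B #<= [set: kappa]) ->
          exists2 K : set F, K #<= [set: kappa] & restr_pres gamma K `#` F)].
Proof.
tfae.
- by move=> kF; split=> [|A AF _]; [apply: ker_sub|apply: ker_vee].
- by move=> [dF kF] I J gamma; apply: local_ker_diamond_pres.
- by move=> pF Z G _ gamma gJ gF _; apply: pF.
- exact: pres_diamond_ker.
Qed.
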